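(* Let $(M,g,Q)$ be a $3$-dimensional Riemannian manifold with circulant structure $Q$ (as defined in the context), with associated metric $\tilde g$, tensor $F=\nabla\tilde g$ and Lee forms $\theta,\theta^{*}$. Let $\alpha$ be a smooth positive function on $M$ and $\overline g(x,y)=\alpha\, g(x,y)$. Let $\overline{\widetilde g}(x,y)=\overline g(x,Qy)+\overline g(Qx,y)$, let $\overline\nabla$ be the Levi-Civita connection of $\overline g$, and let $\overline F(x,y,z)=(\overline\nabla_x\overline{\widetilde g})(y,z)$. Then under this conformal transformation the tensor $F$ is transformed into $$\overline{F}(x,y,z)=\frac{1}{3}\big\{\overline{g}(x,y)\overline{\theta}(z)+\overline{g}(x,z)\overline{\theta}(y)+\overline{\widetilde{g}}(x,y)\overline{\theta}^{*}(z)+\overline{\widetilde{g}}(x,z)\overline{\theta}^{*}(y)\big\},$$ with $$\overline{\theta}=\theta+\frac{3}{2\alpha}\,\mathrm{d}\alpha\circ (Q+ Q^{2}),\qquad \overline{\theta}^{*}=\theta^{*}-\frac{3}{2\alpha}\,\mathrm{d}\alpha .$$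
   Context: Manifold $(M,g,Q)$: $M$ is a $3$-dimensional Riemannian manifold with metric $g$ and a $(1,1)$-tensor field $Q$ satisfying $Q^3=\mathrm{id}$, $Q\neq \mathrm{id}$ and $g(Qx,Qy)=g(x,y)$, such that around every point there are local coordinates $(x^1,x^2,x^3)$ with coordinate basis $e_i=\partial/\partial x^i$ in which $Q$ has the constant circulant matrix $(Q_j^s)=\begin{pmatrix}0&1&0\\ 0&0&1\\ 1&0&0\end{pmatrix}$, where $Qe_j=Q_j^s e_s$ (that is, $Qe_1=e_2$, $Qe_2=e_3$, $Qe_3=e_1$). Necessarily, in this basis $g$ has matrix $(g_{ij})=\begin{pmatrix}A & B & B \\ B & A & B \\ B & B & A\end{pmatrix}$ with $A,B$ smooth functions; it is assumed that $A>B>0$. Associated metric: $\tilde g(x,y)=g(x,Qy)+g(Qx,y)$. Let $\nabla$ be the Levi-Civita connection of $g$. For an arbitrary basis $\{e_i\}$ of $T_pM$, with $(g^{ij})$ the inverse matrix of $(g(e_i,e_j))$ and the summation convention, $$F(x,y,z)=(\nabla_x\tilde g)(y,z),\quad \theta(x)=g^{ij}F(e_i,e_j,x),\quad \theta^{*}(x)=g^{ij}F(e_i,Qe_j,x).$$ *)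

(* Defs.v *)
From HB Require Import structures.
From mathcomp Require Import all_boot all_order all_algebra.
From mathcomp Require Import all_classical all_reals all_analysis.

Set Implicit Arguments.
Unset Strict Implicit.
Unset Printing Implicit Defensive.

Import Order.TTheory GRing.Theory Num.Theory.
Import numFieldNormedType.Exports.

Local Open Scope classical_set_scope.
Local Open Scope ring_scope.

(* The model space of a 3-manifold is 'rV[R]_3; the coordinates x^1, x^2, x^3
   are indexed by 0, 1, 2 : 'I_3. *)

Section EuclideanSmoothness.
Context {R : realType}.

Definition partial (i : 'I_3) (f : 'rV[R]_3 -> R) : 'rV[R]_3 -> R :=
  fun u => 'D_(delta_mx 0 i) f u.

Fixpoint differentiable_upto (k : nat) (U : set 'rV[R]_3)
    (f : 'rV[R]_3 -> R) : Prop :=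
  match k with
  | 0 => forall u, U u -> differentiable f u
  | k'.+1 => (forall u, U u -> differentiable f u) /\
             (forall i, differentiable_upto k' U (partial i f))
  end.

(* C^oo on an open set U: all iterated partial derivatives exist and are
   differentiable (hence continuous) on U. *)
Definition smooth_real (U : set 'rV[R]_3) (f : 'rV[R]_3 -> R) : Prop :=
  forall k, differentiable_upto k U f.

Definition smooth_map (U : set 'rV[R]_3) (f : 'rV[R]_3 -> 'rV[R]_3) : Prop :=
  forall i, smooth_real U (fun u => f u 0 i).

End EuclideanSmoothness.

Section Manifold.
Context {R : realType}.

(* chart_map and chart_inv are total functions, meaningful only on chart_dom
   and on its image. *)
Record chart (M : topologicalType) := Chart {
  chart_dom : set M;
  chart_map : M -> 'rV[R]_3;
  chart_inv : 'rV[R]_3 -> M;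
  chart_dom_open : open chart_dom;
  chart_img_open : open (chart_map @` chart_dom);
  chart_mapK : forall p, chart_dom p -> chart_inv (chart_map p) = p;
  chart_map_continuous : forall p, chart_dom p -> {for p, continuous chart_map};
  chart_inv_continuous : forall p, chart_dom p ->
    {for chart_map p, continuous chart_inv}
}.

Definition compatible (M : topologicalType) (c d : chart M) : Prop :=
  smooth_map (chart_map c @` (chart_dom c `&` chart_dom d))
             (chart_map d \o chart_inv c) /\
  smooth_map (chart_map d @` (chart_dom c `&` chart_dom d))
             (chart_map c \o chart_inv d).

(* A smooth 3-manifold: Hausdorff, second countable, with a maximal smooth
   atlas. chart_at picks one chart around each point; it is only used to
   coordinatize the tangent spaces below. *)
Record manifold := Manifold {
  carrier :> topologicalType;
  manifold_hausdorff : hausdorff_space carrier;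
  manifold_second_countable : @second_countable carrier;
  atlas : set (chart carrier);
  chart_at : carrier -> chart carrier;
  atlas_compatible : forall c d, atlas c -> atlas d -> compatible c d;
  atlas_maximal : forall c,
    (forall d, atlas d -> compatible c d) -> atlas c;
  chart_at_atlas : forall p, atlas (chart_at p);
  mem_chart_at : forall p, chart_dom (chart_at p) p
}.

End Manifold.

Arguments chart : clear implicits.
Arguments manifold : clear implicits.

Section TensorCalculus.
Context {R : realType} {M : manifold R}.
Implicit Types (p q : M) (c : chart R M) (U : set M).

(* T_pM is R^3, a vector being represented by its components in the chart
   chart_at p. The components in any other chart are obtained from the
   derivative of the change of coordinates, see components. *)
Definition tangent (p : M) : vectType R := 'rV[R]_3.

Definition vfield := forall p : M, tangent p.
Definition tensor02 := forall p : M, tangent p -> tangent p -> R.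
Definition tensor11 := forall p : M, tangent p -> tangent p.
Definition tensor03 := forall p : M, tangent p -> tangent p -> tangent p -> R.

Definition components c p (v : tangent p) : 'rV[R]_3 :=
  'D_v (chart_map c \o chart_inv (chart_at p)) (chart_map (chart_at p) p).

(* The coordinate vector d/dx^i at p of the chart c. *)
Definition coord_vec c p (i : 'I_3) : tangent p :=
  'D_(delta_mx 0 i) (chart_map (chart_at p) \o chart_inv c) (chart_map c p).

(* The differential df_p(v), that is, v f. *)
Definition dfun (f : M -> R) p (v : tangent p) : R :=
  'D_v (f \o chart_inv (chart_at p)) (chart_map (chart_at p) p).

Definition smooth_on U (f : M -> R) : Prop :=
  forall c, atlas c ->
    smooth_real (chart_map c @` (chart_dom c `&` U)) (f \o chart_inv c).

Definition vsmooth_on U (X : vfield) : Prop :=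
  forall c, atlas c -> forall i,
    smooth_real (chart_map c @` (chart_dom c `&` U))
      (fun u => components c (X (chart_inv c u)) 0 i).

Definition smooth_near p (f : M -> R) : Prop :=
  exists U, [/\ open U, U p & smooth_on U f].

Definition vsmooth_near p (X : vfield) : Prop :=
  exists U, [/\ open U, U p & vsmooth_on U X].

Record riemannian_metric (g : tensor02) : Prop := {
  metric_linear : forall p (a : R) (x x' y : tangent p),
    g p (a *: x + x') y = a * g p x y + g p x' y;
  metric_sym : forall p x y, g p x y = g p y x;
  metric_pos : forall p (x : tangent p), x != 0 -> 0 < g p x x;
  metric_smooth : forall c, atlas c -> forall i j,
    smooth_real (chart_map c @` chart_dom c)
      (fun u => g (chart_inv c u) (coord_vec c (chart_inv c u) i)
                                  (coord_vec c (chart_inv c u) j))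
}.

Record smooth_tensor11 (Q : tensor11) : Prop := {
  tensor11_linear : forall p (a : R) (x y : tangent p),
    Q p (a *: x + y) = a *: Q p x + Q p y;
  tensor11_smooth : forall c, atlas c -> forall j,
    smooth_map (chart_map c @` chart_dom c)
      (fun u => components c (Q (chart_inv c u) (coord_vec c (chart_inv c u) j)))
}.

(* nabla p v Y is the covariant derivative at p of the vector field Y, smooth
   near p, in the direction v. The Leibniz rule, applied to functions that are
   smooth only near p, forces nabla p v Y to depend only on the germ of Y at p,
   so this is the usual notion of connection. *)
Record affine_connection
    (nabla : forall p, tangent p -> vfield -> tangent p) : Prop := {
  connection_linear : forall p (Y : vfield), vsmooth_near p Y ->
    forall (a : R) (v w : tangent p),
    nabla p (a *: v + w) Y = a *: nabla p v Y + nabla p w Y;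
  connection_add : forall p v (Y Z : vfield),
    vsmooth_near p Y -> vsmooth_near p Z ->
    nabla p v (fun q => Y q + Z q) = nabla p v Y + nabla p v Z;
  connection_leibniz : forall p v (f : M -> R) (Y : vfield),
    smooth_near p f -> vsmooth_near p Y ->
    nabla p v (fun q => f q *: Y q) =
    dfun f v *: Y p + f p *: nabla p v Y;
  connection_smooth : forall U (X Y : vfield), open U ->
    vsmooth_on U X -> vsmooth_on U Y ->
    vsmooth_on U (fun q => nabla q (X q) Y)
}.

(* levi_civita_torsion_free says nabla_X Y - nabla_Y X = [X, Y], the Lie bracket
   being the vector field with [X, Y] f = X (Y f) - Y (X f). *)
Record levi_civita (g : tensor02)
    (nabla : forall p, tangent p -> vfield -> tangent p) : Prop := {
  levi_civita_connection : affine_connection nabla;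
  levi_civita_torsion_free : forall p (X Y : vfield) (f : M -> R),
    vsmooth_near p X -> vsmooth_near p Y -> smooth_near p f ->
    dfun f (nabla p (X p) Y - nabla p (Y p) X) =
    dfun (fun q => dfun f (Y q)) (X p) - dfun (fun q => dfun f (X q)) (Y p);
  levi_civita_metric : forall p (v : tangent p) (Y Z : vfield),
    vsmooth_near p Y -> vsmooth_near p Z ->
    dfun (fun q => g q (Y q) (Z q)) v =
    g p (nabla p v Y) (Z p) + g p (Y p) (nabla p v Z)
}.

(* F(x, y, z) = (nabla_x h)(y, z). The right-hand side below depends only on the
   values Y p and Z p, and every tangent vector extends to a local smooth field,
   so that this determines F. *)
Definition covariant_derivative
    (nabla : forall p, tangent p -> vfield -> tangent p)
    (h : tensor02) (F : tensor03) : Prop :=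
  forall p (x : tangent p) (Y Z : vfield),
    vsmooth_near p Y -> vsmooth_near p Z ->
    F p x (Y p) (Z p) =
    dfun (fun q => h q (Y q) (Z q)) x
      - h p (nabla p x Y) (Z p) - h p (Y p) (nabla p x Z).

(* Only 0 < B < A is asked for, with A = g_11 and B = g_12: the remaining
   entries of the matrix of g follow from the invariance of g under Q. *)
Definition circulant_chart (g : tensor02) (Q : tensor11) c : Prop :=
  forall p, chart_dom c p ->
    [/\ Q p (coord_vec c p 0) = coord_vec c p 1,
        Q p (coord_vec c p 1) = coord_vec c p 2,
        Q p (coord_vec c p 2) = coord_vec c p 0 &
        0 < g p (coord_vec c p 0) (coord_vec c p 1)
          < g p (coord_vec c p 0) (coord_vec c p 0)].

Record circulant_structure (g : tensor02) (Q : tensor11) : Prop := {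
  circulant_metric : riemannian_metric g;
  circulant_tensor : smooth_tensor11 Q;
  circulant_cube : forall p x, Q p (Q p (Q p x)) = x;
  circulant_neq_id : exists p x, Q p x <> x;
  circulant_isometry : forall p x y, g p (Q p x) (Q p y) = g p x y;
  circulant_charts : forall p, exists c : chart R M,
    [/\ atlas c, chart_dom c p & circulant_chart g Q c]
}.

Definition associated_metric (g : tensor02) (Q : tensor11) : tensor02 :=
  fun p x y => g p x (Q p y) + g p (Q p x) y.

Definition conformal_metric (alpha : M -> R) (g : tensor02) : tensor02 :=
  fun p x y => alpha p * g p x y.

Definition inverse_metric (g : tensor02) p (e : 3.-tuple (tangent p)) : 'M[R]_3 :=
  invmx (\matrix_(i, j) g p (tnth e i) (tnth e j)).

Definition lee_form (g : tensor02) (F : tensor03) p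
    (e : 3.-tuple (tangent p)) (x : tangent p) : R :=
  \sum_(i < 3) \sum_(j < 3)
    inverse_metric g e i j * F p (tnth e i) (tnth e j) x.

Definition lee_form_star (g : tensor02) (Q : tensor11) (F : tensor03) p
    (e : 3.-tuple (tangent p)) (x : tangent p) : R :=
  \sum_(i < 3) \sum_(j < 3)
    inverse_metric g e i j * F p (tnth e i) (Q p (tnth e j)) x.

End TensorCalculus.

Arguments tangent {R M} p.
Arguments vfield {R} M.
Arguments tensor02 {R} M.
Arguments tensor11 {R} M.
Arguments tensor03 {R} M.

(* Main.v *)
Require Import Defs.
From HB Require Import structures.
From mathcomp Require Import all_boot all_order all_algebra.
From mathcomp Require Import all_classical all_reals all_analysis.
From mathcomp Require Import ring lra.

(** Around any point take a circulant chart, with [A = g_11] and [B = g_12], put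
    [psi = A + 2 B], let [D] be the sum of the coordinate fields and [omega] the sum
    of the [dx^i]. As [x + Q x + Q^2 x = omega x *: D], the associated metric is
    [g~ = psi omega (x) omega - g] ([associated_metricE]). The metric is parallel, so
    [F] is the covariant derivative of [psi omega (x) omega], and the only part of
    the connection that enters it is [g (nabla_x Y) D], which the Koszul formula gives
    in terms of the derivatives of [A] and [B] ([koszul_diagonal],
    [covariant_derivative_frame]).

    The derivative of [g] along [D] is again circulant, hence a combination
    [tau g + kappa omega (x) omega] with
      [tau = D (A - B) / (A - B)] and [kappa = (A D B - B D A) / (A - B)].
    With the linear form
      [lambda x = 3 / (2 psi) * (kappa omega x - d psi x)]
    this turns [F] into one third of the symmetric expression of the theorem, in which
    [lambda] takes the place of the starred Lee form and [- lambda \o (Q + Q^2)] that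
    of the Lee form ([covariant_derivative_decomposition]). Contracting with the
    inverse metric shows that they are indeed the Lee forms ([lee_form_starE],
    [lee_formE]); this uses only that the contraction of [g] is 3, that [Q] has trace
    zero, and that contracting [g x w * mu y] gives [mu w].

    A conformal metric is again a circulant metric for [Q] in the same charts
    ([conformal_circulant]), so the same formulas hold for it, with [A] and [B]
    multiplied by [alpha]. Then [kappa] and [psi] are multiplied by [alpha], since the
    terms in the derivative of [alpha] cancel in [kappa], while [d psi] becomes
    [alpha d psi + psi d alpha]. Therefore [lambda] changes by [- 3 / (2 alpha) d alpha]
    ([lee_star_conformal]), and composing with [- (Q + Q^2)] gives the change of the
    Lee form. *)

Set Implicit Arguments.
Unset Strict Implicit.
Unset Printing Implicit Defensive.

Import Order.TTheory GRing.Theory Num.Theory.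
Import numFieldNormedType.Exports.

Local Open Scope classical_set_scope.
Local Open Scope ring_scope.

(** * Calculus on the coordinate space *)

(** The differential of [f] is also a first-order approximation of [h], since the
    two functions differ by zero near [x]. *)
Lemma near_eq_differentiable (R : realType) (V W : normedModType R) (f h : V -> W) (x : V) :
  {near x, f =1 h} -> differentiable f x -> differentiable h x.
Proof.
move=> fh df; have [cdf fE] := (diff_locallyP x f).1 df.
have hE : h \o shift x = cst (h x) + 'd f x +o_ 0 id.
  apply/eqaddoP => _/posnumP[e].
  have /eqaddoP/(_ e%:num (ltac:(done))) := fE.
  have fh0 : \forall y \near 0, f (y + x) = h (y + x).
    by move: fh; rewrite [X in X -> _](near_shift 0) /= subr0.
  move=> H; near=> y.
  rewrite /= !fctE /= -(nbhs_singleton fh) -(near fh0 y) //.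
  by near: y.
apply/diff_locallyP; have dE := diff_unique cdf hE.
by rewrite dE.
Unshelve. all: by end_near. Qed.

Lemma derive_linear (R : realType) (V W : normedModType R) (f : V -> W) (x : V)
    (a : R) (v w : V) :
  differentiable f x -> 'D_(a *: v + w) f x = a *: 'D_v f x + 'D_w f x.
Proof. by move=> df; rewrite !deriveE// linearP. Qed.

Lemma derive_comp (R : realType) (U V W : normedModType R) (f : U -> V) (h : V -> W)
    (x v : U) :
  differentiable f x -> differentiable h (f x) ->
  'D_v (h \o f) x = 'D_('D_v f x) h (f x).
Proof.
move=> df dh; rewrite !deriveE//; last exact: differentiable_comp.
by rewrite diff_comp.
Qed.

Lemma differentiable_row (R : realType) (V : normedModType R) n (f : V -> 'rV[R]_n) (x : V) :
  (forall i, differentiable (fun u => f u 0 i) x) -> differentiable f x.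
Proof.
move=> df.
have -> : f = \sum_(i < n) (fun u => f u 0 i *: delta_mx 0 i).
  by apply/funext => u; rewrite fct_sumE [LHS]row_sum_delta.
by apply: differentiable_sum => i; apply: differentiableZl.
Qed.

Lemma derive_row (R : realType) (V : normedModType R) n (f : V -> 'rV[R]_n) (x v : V) i :
  differentiable f x -> 'D_v (fun u => f u 0 i) x = ('D_v f x) 0 i.
Proof.
move=> df; rewrite derive_mx ?mxE //.
exact: diff_derivable.
Qed.

Lemma differentiable_uptoW (R : realType) k (U : set 'rV[R]_3) f :
  differentiable_upto k.+1 U f -> differentiable_upto k U f.
Proof.
elim: k f => [|k IH] f /=; first by case.
by case=> df pf; split=> // i; apply: IH.
Qed.

Lemma eq_differentiable_upto (R : realType) k (U : set 'rV[R]_3) f h :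
  open U -> {in U, f =1 h} -> differentiable_upto k U f -> differentiable_upto k U h.
Proof.
move=> oU; elim: k f h => [|k IH] f h fh /=.
  move=> df u Uu; apply: near_eq_differentiable (df u Uu).
  by apply: filterS (open_nbhs_nbhs (conj oU Uu)) => w Uw; apply: fh; rewrite inE.
move=> [df pf]; have nfh u : U u -> {near u, f =1 h}.
  move=> Uu.
  by apply: filterS (open_nbhs_nbhs (conj oU Uu)) => w Uw; apply: fh; rewrite inE.
split=> [u Uu|i]; first by apply: near_eq_differentiable (df u Uu); exact: nfh.
apply: IH (pf i) => u; rewrite inE => Uu.
by rewrite /partial; apply: near_eq_derive; exact: nfh.
Qed.

Lemma differentiable_uptoD (R : realType) k (U : set 'rV[R]_3) f h : open U ->
  differentiable_upto k U f -> differentiable_upto k U h ->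
  differentiable_upto k U (fun u => f u + h u).
Proof.
move=> oU; elim: k f h => [|k IH] f h /=.
  by move=> df dh u Uu; apply: differentiableD; auto.
move=> [df pf] [dh ph]; split=> [u Uu|i]; first by apply: differentiableD; auto.
apply: eq_differentiable_upto (IH _ _ (pf i) (ph i)) => // u; rewrite inE => Uu.
by rewrite /partial deriveD//; apply: diff_derivable; auto.
Qed.

Lemma differentiable_upto_cst (R : realType) k (U : set 'rV[R]_3) (c : R) :
  differentiable_upto k U (cst c).
Proof.
elim: k c => [|k IH] c /=; first by move=> u _; exact: differentiable_cst.
split=> [u _|i]; first exact: differentiable_cst.
have -> : partial i (cst c) = cst 0 by apply/funext => u; rewrite /partial derive_cst.
exact: IH.
Qed.

Lemma differentiable_upto_sum (R : realType) k (U : set 'rV[R]_3) n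
    (f : 'I_n -> 'rV[R]_3 -> R) :
  open U -> (forall i, differentiable_upto k U (f i)) ->
  differentiable_upto k U (fun u => \sum_(i < n) f i u).
Proof.
move=> oU; elim: n f => [|n IH] f df.
  rewrite (_ : (fun u => _) = cst 0); first exact: differentiable_upto_cst.
  by apply/funext => u; rewrite big_ord0.
rewrite (_ : (fun u => _) =
  (fun u => \sum_(i < n) f (widen_ord (leqnSn n) i) u + f ord_max u)).
  by apply: differentiable_uptoD => //; exact: IH.
by apply/funext => u; rewrite big_ord_recr.
Qed.

(** The Leibniz rule expresses the partial derivatives of a product by products of
    functions that are one order less differentiable, whence the induction on [k]. *)
Lemma differentiable_uptoM (R : realType) k (U : set 'rV[R]_3) f h : open U ->
  differentiable_upto k U f -> differentiable_upto k U h ->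
  differentiable_upto k U (fun u => f u * h u).
Proof.
move=> oU; elim: k f h => [|k IH] f h.
  by move=> df dh u Uu; apply: differentiableM; auto.
move=> df1 dh1; have df := differentiable_uptoW df1; have dh := differentiable_uptoW dh1.
case: df1 dh1 => [df1 pf] [dh1 ph]; split=> [u Uu|i].
  by apply: differentiableM; auto.
have dsum := differentiable_uptoD oU (IH _ _ df (ph i)) (IH _ _ dh (pf i)).
apply: eq_differentiable_upto dsum => // u.
rewrite inE => Uu; rewrite /partial deriveM//; apply: diff_derivable; auto.
Qed.

(** By the chain rule the partial derivatives of [f \o e] are sums of products of
    [partial j f \o e], to which the induction hypothesis applies, and of partial
    derivatives of the components of [e]. *)
Lemma differentiable_upto_comp (R : realType) k (U V : set 'rV[R]_3) f
    (e : 'rV[R]_3 -> 'rV[R]_3) :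
  open U -> (forall u, U u -> V (e u)) ->
  differentiable_upto k V f -> (forall i, differentiable_upto k U (fun u => e u 0 i)) ->
  differentiable_upto k U (f \o e).
Proof.
move=> oU eUV; elim: k f => [|k IH] f.
  move=> df de u Uu; apply: differentiable_comp; last exact/(df _ _)/eUV.
  by apply: differentiable_row => i; exact: (de i u Uu).
move=> [df pf] de.
have de0 u : U u -> differentiable e u.
  by move=> Uu; apply: differentiable_row => i; case: (de i) => + _; exact.
split=> [u Uu|i].
  by apply: differentiable_comp; [exact: de0 | exact/df/eUV].
have pfe j : differentiable_upto k U
    (fun u => partial j f (e u) * partial i (fun u => e u 0 j) u).
  apply: differentiable_uptoM => //; last by case: (de j) => _; exact.
  by apply: IH (pf j) _ => l; exact: differentiable_uptoW.
apply: eq_differentiable_upto (differentiable_upto_sum oU pfe) => // u.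
rewrite inE => Uu; rewrite /partial derive_comp//; [|exact: de0|exact/(df _ _)/eUV].
rewrite deriveE; last exact/(df _ _)/eUV.
rewrite [X in 'd f _ X]row_sum_delta linear_sum; apply: eq_bigr => j _.
rewrite linearZ /= derive_row; last exact: de0.
rewrite /partial [RHS]mulrC; congr (_ * _); rewrite deriveE//.
exact/(df _ _)/eUV.
Qed.

Lemma smooth_real_comp (R : realType) (U V : set 'rV[R]_3) f (e : 'rV[R]_3 -> 'rV[R]_3) :
  open U -> (forall u, U u -> V (e u)) ->
  smooth_real V f -> smooth_map U e -> smooth_real U (f \o e).
Proof.
move=> oU eUV sf se k.
exact: (differentiable_upto_comp oU eUV (sf k) (fun i => se i k)).
Qed.

Lemma smooth_map_differentiable (R : realType) (U : set 'rV[R]_3) e u :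
  smooth_map U e -> U u -> differentiable e u.
Proof. by move=> se Uu; apply: differentiable_row => i; exact: (se i 0). Qed.

Lemma smooth_real_partial (R : realType) (U : set 'rV[R]_3) f i :
  smooth_real U f -> smooth_real U (partial i f).
Proof. by move=> sf k; case: (sf k.+1) => _; exact. Qed.

Lemma smooth_realM (R : realType) (U : set 'rV[R]_3) (f h : 'rV[R]_3 -> R) : open U ->
  smooth_real U f -> smooth_real U h -> smooth_real U (fun u => f u * h u).
Proof. by move=> oU sf sh k; apply: differentiable_uptoM. Qed.

Lemma derive_comb (R : realType) (V : normedModType R) (f h : V -> R) (a b : R) (x v : V) :
  differentiable f x -> differentiable h x ->
  'D_v (fun u => a * f u + b * h u) x = a * 'D_v f x + b * 'D_v h x.
Proof.
move=> df dh.
have dfv := @diff_derivable _ _ _ _ _ v df; have dhv := @diff_derivable _ _ _ _ _ v dh.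
rewrite -[a * _](@deriveZ _ _ _ f a x v dfv) -[b * _](@deriveZ _ _ _ h b x v dhv).
by rewrite -(deriveD (@derivableZ _ _ _ f a x v dfv) (@derivableZ _ _ _ h b x v dhv)).
Qed.

Lemma derive_mul (R : realType) (V : normedModType R) (f h : V -> R) (x v : V) :
  differentiable f x -> differentiable h x ->
  'D_v (fun u => f u * h u) x = f x * 'D_v h x + h x * 'D_v f x.
Proof. by move=> df dh; apply: deriveM; exact: diff_derivable. Qed.

(** * Charts and fields with constant components *)

Lemma open_chart_image (R : realType) (M : topologicalType) (c : chart R M) (U : set M) :
  open U -> open (chart_map c @` (chart_dom c `&` U)).
Proof.
move=> oU; rewrite openE => _ [p [cp Up] <-].
have cimg : nbhs (chart_map c p) (chart_map c @` chart_dom c).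
  by apply: open_nbhs_nbhs; split; [exact: chart_img_open | exists p].
have nU : nbhs (chart_inv c (chart_map c p)) U.
  by rewrite chart_mapK//; apply: open_nbhs_nbhs.
apply: filterS2 cimg (chart_inv_continuous cp nU) => _ [q cq <-] /=.
by rewrite chart_mapK// => Uq; exists q.
Qed.

Lemma near_chart_inv (R : realType) (M : topologicalType) (c : chart R M) p (P : M -> Prop) :
  chart_dom c p -> (\forall q \near p, P q) ->
  \forall u \near chart_map c p, P (chart_inv c u).
Proof. by move=> cp nP; apply: (chart_inv_continuous cp); rewrite chart_mapK. Qed.

Lemma near_chart_invK (R : realType) (M : topologicalType) (c : chart R M) p :
  chart_dom c p -> \forall u \near chart_map c p, chart_map c (chart_inv c u) = u.
Proof.
move=> cp.
have cimg : nbhs (chart_map c p) (chart_map c @` chart_dom c).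
  by apply: open_nbhs_nbhs; split; [exact: chart_img_open | exists p].
by apply: filterS cimg => _ [q cq <-]; rewrite chart_mapK.
Qed.

Lemma near_chart_dom (R : realType) (M : topologicalType) (c : chart R M) p :
  chart_dom c p -> \forall q \near p, chart_dom c q.
Proof. by move=> cp; apply: open_nbhs_nbhs; split=> //; exact: chart_dom_open. Qed.

Lemma differentiable_transition (R : realType) (M : manifold R) (c d : chart R M) p :
  atlas c -> atlas d -> chart_dom c p -> chart_dom d p ->
  differentiable (chart_map d \o chart_inv c) (chart_map c p).
Proof.
move=> ac ad cp dp; apply: smooth_map_differentiable (atlas_compatible ac ad).1 _.
by exists p.
Qed.

Lemma near_change_chart (R : realType) (M : topologicalType) (W : Type) (f : M -> W)
    (c d : chart R M) p :
  chart_dom c p -> chart_dom d p ->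
  {near chart_map c p,
    ((f \o chart_inv d) \o (chart_map d \o chart_inv c)) =1 f \o chart_inv c}.
Proof.
move=> cp dp.
apply: (near_chart_inv (P := fun q => f (chart_inv d (chart_map d q)) = f q)) => //.
by apply: filterS (near_chart_dom dp) => q dq; rewrite chart_mapK.
Qed.

Lemma differentiable_change_chart (R : realType) (M : manifold R) (W : normedModType R)
    (f : M -> W) (c d : chart R M) p :
  atlas c -> atlas d -> chart_dom c p -> chart_dom d p ->
  differentiable (f \o chart_inv d) (chart_map d p) ->
  differentiable (f \o chart_inv c) (chart_map c p).
Proof.
move=> ac ad cp dp df; apply: near_eq_differentiable (near_change_chart f cp dp) _.
apply: differentiable_comp; first exact: differentiable_transition.
by rewrite /= chart_mapK.
Qed.

(** This is the chain rule for a change of chart. With [f] a coordinate map it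
    relates components in two charts; with [f] real-valued it shows that [dfun] can
    be computed in any chart. *)
Lemma derive_change_chart (R : realType) (M : manifold R) (W : normedModType R)
    (f : M -> W) (c d : chart R M) p (v : 'rV[R]_3) :
  atlas c -> atlas d -> chart_dom c p -> chart_dom d p ->
  differentiable (f \o chart_inv d) (chart_map d p) ->
  'D_v (f \o chart_inv c) (chart_map c p) =
  'D_('D_v (chart_map d \o chart_inv c) (chart_map c p)) (f \o chart_inv d) (chart_map d p).
Proof.
move=> ac ad cp dp df; rewrite -(near_eq_derive _ (near_change_chart f cp dp)).
by rewrite derive_comp /= ?chart_mapK//; exact: differentiable_transition.
Qed.

Lemma derive_chart_id (R : realType) (M : manifold R) (c : chart R M) p (v : 'rV[R]_3) :
  chart_dom c p -> 'D_v (chart_map c \o chart_inv c) (chart_map c p) = v.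
Proof.
move=> cp; rewrite (@near_eq_derive _ _ _ _ id _ v (near_chart_invK cp)).
exact: derive_id.
Qed.

(** The vector field on the domain of [c] with constant components [v]. It is locked,
    like the other local quantities below, because unification would otherwise
    unfold it to a limit of difference quotients. *)
HB.lock Definition frame (R : realType) (M : manifold R) (c : chart R M)
    (v : 'rV[R]_3) : vfield M :=
  fun q => 'D_v (chart_map (chart_at q) \o chart_inv c) (chart_map c q).

Lemma components_frame (R : realType) (M : manifold R) (c d : chart R M) q (v : 'rV[R]_3) :
  atlas c -> atlas d -> chart_dom c q -> chart_dom d q ->
  components d (frame c v q) = 'D_v (chart_map d \o chart_inv c) (chart_map c q).
Proof.
move=> ac ad cq dq; rewrite frame.unlock [RHS](derive_change_chart v ac (chart_at_atlas q)) //.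
  exact: mem_chart_at.
apply: differentiable_transition => //; [exact: chart_at_atlas|exact: mem_chart_at].
Qed.

Lemma components_frameK (R : realType) (M : manifold R) (c : chart R M) q (v : 'rV[R]_3) :
  atlas c -> chart_dom c q -> components c (frame c v q) = v.
Proof. by move=> ac cq; rewrite components_frame// derive_chart_id. Qed.

Lemma frame_componentsK (R : realType) (M : manifold R) (c : chart R M) q (w : tangent q) :
  atlas c -> chart_dom c q -> frame c (components c w) q = w.
Proof.
move=> ac cq; rewrite frame.unlock /components -derive_change_chart//.
- by rewrite derive_chart_id//; exact: mem_chart_at.
- exact: chart_at_atlas.
- exact: mem_chart_at.
- by apply: differentiable_transition => //; [exact: chart_at_atlas|exact: mem_chart_at].
Qed.

Lemma frameE (R : realType) (M : manifold R) (c : chart R M) q (v : 'rV[R]_3) :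
  atlas c -> chart_dom c q -> frame c v q = \sum_i v 0 i *: coord_vec c q i.
Proof.
move=> ac cq; have dT : differentiable (chart_map (chart_at q) \o chart_inv c) (chart_map c q).
  by apply: differentiable_transition => //; [exact: chart_at_atlas|exact: mem_chart_at].
rewrite frame.unlock /coord_vec deriveE// [X in 'd _ _ X]row_sum_delta linear_sum.
by apply: eq_bigr => i _; rewrite linearZ /= deriveE.
Qed.

Lemma components_linear (R : realType) (M : manifold R) (c : chart R M) q (a : R)
    (v w : tangent q) :
  atlas c -> chart_dom c q ->
  components c (a *: v + w) = a *: components c v + components c w.
Proof.
move=> ac cq; apply: derive_linear; apply: differentiable_transition => //.
  exact: chart_at_atlas.
exact: mem_chart_at.
Qed.

Lemma dfun_coordinate (R : realType) (M : manifold R) (c : chart R M) q (w : tangent q) k :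
  atlas c -> chart_dom c q ->
  dfun (fun r => chart_map c r 0 k) w = components c w 0 k.
Proof.
move=> ac cq; apply: derive_row; apply: differentiable_transition => //.
  exact: chart_at_atlas.
exact: mem_chart_at.
Qed.

Lemma smooth_coordinate (R : realType) (M : manifold R) (c : chart R M) q k :
  atlas c -> chart_dom c q -> smooth_near q (fun r => chart_map c r 0 k).
Proof.
move=> ac cq; exists (chart_dom c); split=> //; first exact: chart_dom_open.
by move=> d ad; exact: (atlas_compatible ad ac).1.
Qed.

Lemma smooth_real_derive (R : realType) (U : set 'rV[R]_3) (f : 'rV[R]_3 -> R) (v : 'rV[R]_3) :
  open U -> smooth_real U f -> smooth_real U (fun u => 'D_v f u).
Proof.
move=> oU sf k.
have pf i : differentiable_upto k U (fun u => v 0 i * partial i f u).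
  apply: differentiable_uptoM => //; first exact: differentiable_upto_cst.
  exact: smooth_real_partial.
apply: eq_differentiable_upto (differentiable_upto_sum oU pf) => // u.
rewrite inE => Uu; rewrite deriveE; last exact: (sf 0%N).
rewrite [X in 'd f _ X]row_sum_delta linear_sum; apply: eq_bigr => i _.
by rewrite linearZ /= /partial deriveE//; exact: (sf 0%N).
Qed.

(** In a chart [d] the components are the directional derivatives of the transition
    map from [c] to [d], read through the transition map from [d] to [c]. *)
Lemma vsmooth_frame (R : realType) (M : manifold R) (c : chart R M) q (v : 'rV[R]_3) :
  atlas c -> chart_dom c q -> vsmooth_near q (frame c v).
Proof.
move=> ac cq; exists (chart_dom c); split=> //; first exact: chart_dom_open.
move=> d ad i.
have [cd dc] := atlas_compatible ac ad.
have oU := @open_chart_image _ _ d _ (chart_dom_open c).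
have oV := @open_chart_image _ _ c _ (chart_dom_open d).
have smooth_column := smooth_real_comp (e := chart_map c \o chart_inv d) oU _
  (smooth_real_derive v oV (cd i)) _.
move=> k; apply: eq_differentiable_upto (smooth_column _ _ k) => //.
- move=> u; rewrite inE => -[r [dr cr] <-] /=.
  rewrite chart_mapK// components_frame//; apply: derive_row.
  exact: differentiable_transition.
- by move=> u [r [dr cr] <-] /=; rewrite chart_mapK//; exists r.
- by rewrite setIC.
Qed.

(** * Differentials of functions on the manifold *)

Lemma eq_dfun (R : realType) (M : manifold R) (f h : M -> R) p (v : tangent p) :
  {near p, f =1 h} -> dfun f v = dfun h v.
Proof.
move=> fh; apply: near_eq_derive.
exact: (near_chart_inv (P := fun q => f q = h q) (mem_chart_at p) fh).
Qed.

Definition differentiable_at (R : realType) (M : manifold R) (f : M -> R) p :=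
  differentiable (f \o chart_inv (chart_at p)) (chart_map (chart_at p) p).

Lemma dfun_linear (R : realType) (M : manifold R) (f : M -> R) p (a : R) (v w : tangent p) :
  differentiable_at f p -> dfun f (a *: v + w) = a * dfun f v + dfun f w.
Proof. exact: derive_linear. Qed.

Lemma dfun_cst (R : realType) (M : manifold R) (k : R) p (v : tangent p) :
  dfun (fun _ : M => k) v = 0.
Proof. exact: derive_cst. Qed.

Lemma dfun_comb (R : realType) (M : manifold R) (f h : M -> R) (a b : R) p (v : tangent p) :
  differentiable_at f p -> differentiable_at h p ->
  dfun (fun q => a * f q + b * h q) v = a * dfun f v + b * dfun h v.
Proof. by move=> df dh; exact: (derive_comb a b v df dh). Qed.

Lemma dfunM (R : realType) (M : manifold R) (f h : M -> R) p (v : tangent p) :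
  differentiable_at f p -> differentiable_at h p ->
  dfun (fun q => f q * h q) v = f p * dfun h v + h p * dfun f v.
Proof.
move=> df dh; rewrite /dfun derive_mul//= chart_mapK//; exact: mem_chart_at.
Qed.

(** * Circulant bilinear forms *)

Lemma sum3 (V : nmodType) (f : 'I_3 -> V) : \sum_(i < 3) f i = f 0 + f 1 + f 2.
Proof.
rewrite !big_ord_recl big_ord0 addr0 addrA; congr (f _ + f _ + f _); exact: val_inj.
Qed.

Definition coord_sum (R : realType) (v : 'rV[R]_3) : R := \sum_i v 0 i.
Definition coord_dot (R : realType) (v w : 'rV[R]_3) : R := \sum_i v 0 i * w 0 i.

(** The pointwise linear algebra: the isometry [Q] permutes three vectors [E i]
    cyclically, so that their Gram matrix for [b] is circulant, with [A] on the diagonal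
    and [B] off it. *)
Section CirculantSpace.
Context (R : realType) (V : lmodType R) (b : V -> V -> R) (Q : V -> V) (E : 'I_3 -> V).
Context (b_linear : forall a x x' y, b (a *: x + x') y = a * b x y + b x' y).
Context (b_sym : forall x y, b x y = b y x).
Context (Q_linear : forall a x y, Q (a *: x + y) = a *: Q x + Q y).
Context (Q_isometry : forall x y, b (Q x) (Q y) = b x y).
Context (QE0 : Q (E 0) = E 1) (QE1 : Q (E 1) = E 2) (QE2 : Q (E 2) = E 0).

Local Notation A := (b (E 0) (E 0)).
Local Notation B := (b (E 0) (E 1)).
Local Notation comb v := (\sum_i v 0 i *: E i).
Local Notation S := (\sum_i E i).

Lemma bilinDl x y z : b (x + y) z = b x z + b y z.
Proof. by have := b_linear 1 x y z; rewrite scale1r mul1r. Qed.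

Lemma bilin0l z : b 0 z = 0.
Proof. by apply: (addrI (b 0 z)); rewrite -bilinDl !addr0. Qed.

Lemma bilinZl a x z : b (a *: x) z = a * b x z.
Proof. by have := b_linear a x 0 z; rewrite !addr0 bilin0l addr0. Qed.

Lemma bilinDr x y z : b z (x + y) = b z x + b z y.
Proof. by rewrite b_sym bilinDl !(b_sym z). Qed.

Lemma bilinZr a x z : b z (a *: x) = a * b z x.
Proof. by rewrite b_sym bilinZl b_sym. Qed.

Lemma endoD x y : Q (x + y) = Q x + Q y.
Proof. by have := Q_linear 1 x y; rewrite !scale1r. Qed.

Lemma endo0 : Q 0 = 0.
Proof. by apply: (addrI (Q 0)); rewrite -endoD !addr0. Qed.

Lemma endoZ a x : Q (a *: x) = a *: Q x.
Proof. by have := Q_linear a x 0; rewrite !addr0 endo0 addr0. Qed.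

Lemma form_circulant_entries :
  [/\ b (E 1) (E 1) = A, b (E 2) (E 2) = A, b (E 1) (E 2) = B & b (E 2) (E 0) = B].
Proof.
have b11 := Q_isometry (E 0) (E 0); have b22 := Q_isometry (E 1) (E 1).
have b12 := Q_isometry (E 0) (E 1); have b20 := Q_isometry (E 1) (E 2).
move: b11 b22 b12 b20; rewrite QE2 QE1 QE0 => b11 b22 b12 b20.
by split=> //; rewrite ?b22 ?b20.
Qed.

Lemma form_comb (v w : 'rV[R]_3) :
  b (comb v) (comb w) =
  coord_dot v w * A + (coord_sum v * coord_sum w - coord_dot v w) * B.
Proof.
have [b11 b22 b12 b20] := form_circulant_entries.
rewrite /coord_sum /coord_dot !sum3 !(bilinDl, bilinDr, bilinZl, bilinZr).
rewrite (b_sym (E 1) (E 0)) (b_sym (E 2) (E 1)) (b_sym (E 0) (E 2)) b11 b22 b12 b20.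
by ring.
Qed.

Lemma form_comb_sum (v : 'rV[R]_3) : b (comb v) S = (A + 2 * B) * coord_sum v.
Proof.
have [b11 b22 b12 b20] := form_circulant_entries.
rewrite /coord_sum !sum3 !(bilinDl, bilinDr, bilinZl, bilinZr).
rewrite (b_sym (E 1) (E 0)) (b_sym (E 2) (E 1)) (b_sym (E 0) (E 2)) b11 b22 b12 b20.
by ring.
Qed.

Lemma circulant_fixes_sum : Q S = S.
Proof. by rewrite !sum3 !endoD QE0 QE1 QE2 [LHS]addrC addrA. Qed.

(** Each [E i] runs through the whole family under [1], [Q], [Q^2], so its orbit
    sums to [S]. *)
Lemma circulant_orbit_comb (v : 'rV[R]_3) :
  comb v + Q (comb v) + Q (Q (comb v)) = coord_sum v *: S.
Proof.
rewrite /coord_sum !sum3 !(endoD, endoZ) !(QE0, QE1, QE2).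
rewrite [RHS]scalerDl [in RHS]scalerDl !scalerDr.
by rewrite !addrA (ACl (1*4*7*8*2*5*6*9*3)).
Qed.

End CirculantSpace.

(** * Contraction with a metric *)

Lemma linear_form_comb (K : fieldType) (V : lmodType K) (f : V -> K) n
    (a : 'I_n -> K) (x : 'I_n -> V) :
  (forall a x y, f (a *: x + y) = a * f x + f y) ->
  f (\sum_i a i *: x i) = \sum_i a i * f (x i).
Proof.
move=> lf; have f0 : f 0 = 0.
  by have := lf (-1) 0 0; rewrite scaler0 addr0 mulN1r addNr.
elim: n a x => [|n IH] a x; first by rewrite !big_ord0.
by rewrite !big_ord_recl lf IH.
Qed.

(** Contraction of bilinear forms with the inverse of the Gram matrix of an
    arbitrary basis. Everything follows from [metric_contraction_right], which
    expresses that the contraction of [mu] with the form dual to [w] is [mu w], and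
    which makes no reference to the basis. *)
Section Contraction.
Context (R : realFieldType) (V : vectType R) (b : V -> V -> R).
Context (b_linear : forall a x x' y, b (a *: x + x') y = a * b x y + b x' y).
Context (b_sym : forall x y, b x y = b y x) (b_pos : forall x, x != 0 -> 0 < b x x).
Context (n : nat) (e : n.-tuple V) (e_basis : basis_of fullv e).

Local Notation G := (\matrix_(i, j) b (tnth e i) (tnth e j)).

Definition metric_contraction (beta : V -> V -> R) : R :=
  \sum_(i < n) \sum_(j < n) invmx G i j * beta (tnth e i) (tnth e j).

(** A null vector [v] of the Gram matrix would give a vector [x] with [b x x = 0]. *)
Lemma gram_unit : G \in unitmx.
Proof.
rewrite unitmxE unitfE; apply/det0P => -[v v0 vG].
pose x := \sum_i v 0 i *: tnth e i.
have bx y : b x y = \sum_i v 0 i * b (tnth e i) y by exact: (@linear_form_comb _ _ (b ^~ y)).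
have xx0 : b x x = 0.
  rewrite bx big1// => j _; rewrite b_sym bx.
  have /rowP/(_ j) := vG; rewrite !mxE.
  by under eq_bigr do rewrite mxE; move=> ->; rewrite mulr0.
have x0 : x == 0 by apply: contraT => /b_pos; rewrite xx0 ltxx.
move: v0; rewrite -subr_eq0 => /negP; apply.
apply/eqP/rowP => i; rewrite !mxE subr0.
have /freeP := basis_free e_basis; apply; rewrite -[RHS](eqP x0).
by apply: eq_bigr => j _; rewrite (tnth_nth 0).
Qed.

Lemma metric_contraction_right (mu : V -> R) (w : V) :
  (forall a x y, mu (a *: x + y) = a * mu x + mu y) ->
  metric_contraction (fun x y => mu x * b y w) = mu w.
Proof.
move=> lmu; have wE := coord_basis e_basis (memvf w).
set a := fun i => coord e i w.
have wE' : w = \sum_i a i *: tnth e i.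
  by rewrite [LHS]wE; apply: eq_bigr => i _; rewrite (tnth_nth 0).
rewrite /metric_contraction [in RHS]wE' linear_form_comb//.
have bw j : b (tnth e j) w = \sum_k G j k * a k.
  rewrite b_sym [X in b X _]wE' (@linear_form_comb _ _ (b ^~ _))//.
  by apply: eq_bigr => k _; rewrite mxE mulrC b_sym.
apply: eq_bigr => i _.
transitivity (mu (tnth e i) * \sum_j \sum_k invmx G i j * G j k * a k).
  rewrite mulr_sumr; apply: eq_bigr => j _; rewrite bw mulrCA mulr_sumr; congr (_ * _).
  by apply: eq_bigr => k _; rewrite mulrA.
rewrite exchange_big /= mulrC; congr (_ * _).
transitivity (\sum_k (1%:M : 'M[R]_n) i k * a k).
  apply: eq_bigr => k _; rewrite -mulr_suml -(mulVmx gram_unit) [in RHS]mxE.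
  by [].
rewrite (bigD1 i)//= big1 ?addr0 ?mxE ?eqxx ?mul1r// => k ki.
by rewrite mxE eq_sym (negPf ki) mul0r.
Qed.

Lemma metric_contraction_sym beta :
  metric_contraction beta = metric_contraction (fun x y => beta y x).
Proof.
rewrite /metric_contraction exchange_big; apply: eq_bigr => i _; apply: eq_bigr => j _.
congr (_ * _); have GT : G^T = G by apply/matrixP => k l; rewrite !mxE b_sym.
by rewrite -[in LHS]GT -trmx_inv mxE.
Qed.

Lemma metric_contraction_left (mu : V -> R) (w : V) :
  (forall a x y, mu (a *: x + y) = a * mu x + mu y) ->
  metric_contraction (fun x y => b x w * mu y) = mu w.
Proof.
move=> lmu; rewrite metric_contraction_sym -[RHS](metric_contraction_right _ lmu).
by apply: eq_bigr => i _; apply: eq_bigr => j _; rewrite [b _ _ * _]mulrC.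
Qed.

Lemma eq_metric_contraction beta gamma :
  (forall x y, beta x y = gamma x y) -> metric_contraction beta = metric_contraction gamma.
Proof. by move=> bg; apply: eq_bigr => i _; apply: eq_bigr => j _; rewrite bg. Qed.

Lemma metric_contraction_comb k beta gamma :
  metric_contraction (fun x y => k * beta x y + gamma x y) =
  k * metric_contraction beta + metric_contraction gamma.
Proof.
rewrite /metric_contraction mulr_sumr -big_split; apply: eq_bigr => i _.
rewrite /= mulr_sumr -big_split; apply: eq_bigr => j _ /=; ring.
Qed.

Lemma metric_contraction_sum m (beta : 'I_m -> V -> V -> R) :
  metric_contraction (fun x y => \sum_(k < m) beta k x y) =
  \sum_(k < m) metric_contraction (beta k).
Proof.
rewrite /metric_contraction [RHS]exchange_big; apply: eq_bigr => i _ /=.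
by rewrite [RHS]exchange_big; apply: eq_bigr => j _; rewrite mulr_sumr.
Qed.

(** Expanding [L y] in the frame [E], with dual frame [u], writes the bilinear form as
    a sum of terms to which [metric_contraction_left] applies; hence the contraction
    is the trace of [L]. *)
Lemma metric_contraction_trace m (E : 'I_m -> V) (u : 'I_m -> V -> R) (L : V -> V) :
  (forall k a x y, u k (a *: x + y) = a * u k x + u k y) ->
  (forall a x y, L (a *: x + y) = a *: L x + L y) ->
  (forall x, x = \sum_k u k x *: E k) ->
  metric_contraction (fun x y => b x (L y)) = \sum_k u k (L (E k)).
Proof.
move=> lu lL uE.
transitivity (\sum_(k < m) metric_contraction (fun x y => b x (E k) * u k (L y))); last first.
  apply: eq_bigr => k _.
  apply: (metric_contraction_left (E k) (mu := fun y => u k (L y))) => a x y.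
  by rewrite lL lu.
rewrite -metric_contraction_sum; apply: eq_metric_contraction => x y.
rewrite b_sym [X in b X _]uE (@linear_form_comb _ _ (b ^~ x))//.
by apply: eq_bigr => k _; rewrite mulrC b_sym.
Qed.

End Contraction.

(** * The covariant derivative of the associated metric *)

HB.lock Definition diagonal_entry (R : realType) (M : manifold R) (g : tensor02 M)
    (c : chart R M) (q : M) : R :=
  g q (coord_vec c q 0) (coord_vec c q 0).

HB.lock Definition offdiagonal_entry (R : realType) (M : manifold R) (g : tensor02 M)
    (c : chart R M) (q : M) : R :=
  g q (coord_vec c q 0) (coord_vec c q 1).

(** The closed 1-form [dx^1 + dx^2 + dx^3] of the chart, written [omega] below. *)
HB.lock Definition coord_form (R : realType) (M : manifold R) (c : chart R M) (q : M)
    (x : tangent q) : R :=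
  coord_sum (components c x).

HB.lock Definition coord_product (R : realType) (M : manifold R) (c : chart R M) (q : M)
    (x y : tangent q) : R :=
  coord_dot (components c x) (components c y).

(** The differential of [diagonal_eigenvalue]. *)
HB.lock Definition eigenvalue_diff (R : realType) (M : manifold R) (g : tensor02 M)
    (c : chart R M) (q : M) (x : tangent q) : R :=
  dfun (diagonal_entry g c) x + 2 * dfun (offdiagonal_entry g c) x.

Section CirculantManifold.
Context (R : realType) (M : manifold R) (g : tensor02 M) (Q : tensor11 M).
Context (gQ : circulant_structure g Q).
Context (c : chart R M) (ac : atlas c) (cQ : circulant_chart g Q c).

Let gM : riemannian_metric g := circulant_metric gQ.
Let Q_linear q a (x y : tangent q) : Q (a *: x + y) = a *: Q x + Q y :=
  tensor11_linear (circulant_tensor gQ) a x y.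

(** The sum of the three coordinate fields; it spans the axis fixed by [Q]. *)
Definition diagonal_field : vfield M := frame c (const_mx 1).
Local Notation entryA := (diagonal_entry g c).
Local Notation entryB := (offdiagonal_entry g c).
Local Notation omega := (coord_form c).
(** The eigenvalue of the circulant Gram matrix on the vector [(1, 1, 1)]. *)
Definition diagonal_eigenvalue q : R := entryA q + 2 * entryB q.

Lemma entry_bounds q : chart_dom c q -> 0 < entryB q < entryA q.
Proof.
by move=> cq; rewrite diagonal_entry.unlock offdiagonal_entry.unlock; have [] := cQ cq.
Qed.

Lemma diagonal_eigenvalue_gt0 q : chart_dom c q -> 0 < diagonal_eigenvalue q.
Proof. by move=> /entry_bounds; rewrite /diagonal_eigenvalue => /andP[B0 AB]; lra. Qed.

Lemma diagonal_fieldE q : chart_dom c q -> diagonal_field q = \sum_i coord_vec c q i.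
Proof.
move=> cq; rewrite /diagonal_field frameE//.
by apply: eq_bigr => i _; rewrite mxE scale1r.
Qed.

Lemma componentsE q (x : tangent q) : chart_dom c q ->
  x = \sum_i components c x 0 i *: coord_vec c q i.
Proof. by move=> cq; rewrite -frameE// frame_componentsK. Qed.

Lemma metric_frame q (v w : 'rV[R]_3) : chart_dom c q ->
  g (frame c v q) (frame c w q) =
  coord_dot v w * entryA q + (coord_sum v * coord_sum w - coord_dot v w) * entryB q.
Proof.
move=> cq; have [Q0 Q1 Q2 _] := cQ cq; rewrite !frameE//.
rewrite diagonal_entry.unlock offdiagonal_entry.unlock.
exact: (form_comb (metric_linear gM (p:=q)) (Defs.metric_sym gM (p:=q))
          (circulant_isometry gQ (p:=q)) Q0 Q1 Q2).
Qed.

Lemma metric_components q (x y : tangent q) : chart_dom c q ->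
  g x y = coord_product c x y * entryA q +
    (omega x * omega y - coord_product c x y) * entryB q.
Proof.
move=> cq; rewrite coord_form.unlock coord_product.unlock -metric_frame//.
by rewrite (frame_componentsK x ac cq) (frame_componentsK y ac cq).
Qed.

Lemma metric_diagonal q (x : tangent q) : chart_dom c q ->
  g x (diagonal_field q) = diagonal_eigenvalue q * omega x.
Proof.
move=> cq; have [Q0 Q1 Q2 _] := cQ cq; rewrite diagonal_fieldE// {1}(componentsE x cq).
rewrite coord_form.unlock /diagonal_eigenvalue diagonal_entry.unlock offdiagonal_entry.unlock.
exact: (form_comb_sum (metric_linear gM (p:=q)) (Defs.metric_sym gM (p:=q))
          (circulant_isometry gQ (p:=q)) Q0 Q1 Q2).
Qed.

Lemma circulant_diagonal q : chart_dom c q -> Q (diagonal_field q) = diagonal_field q.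
Proof.
move=> cq; have [Q0 Q1 Q2 _] := cQ cq; rewrite diagonal_fieldE//.
exact: (circulant_fixes_sum (Q_linear (q:=q)) Q0 Q1 Q2).
Qed.

Lemma circulant_orbit_sum q (x : tangent q) : chart_dom c q ->
  x + Q x + Q (Q x) = omega x *: diagonal_field q.
Proof.
move=> cq; have [Q0 Q1 Q2 _] := cQ cq; rewrite diagonal_fieldE//.
rewrite {1 2 3}(componentsE x cq) coord_form.unlock.
exact: (circulant_orbit_comb (Q_linear (q:=q)) Q0 Q1 Q2).
Qed.

Lemma coord_form_circulant q (x : tangent q) : chart_dom c q -> omega (Q x) = omega x.
Proof.
move=> cq; apply: (mulfI (lt0r_neq0 (diagonal_eigenvalue_gt0 cq))).
rewrite -(metric_diagonal (Q x) cq) -(metric_diagonal x cq).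
by rewrite -{1}(circulant_diagonal cq) (circulant_isometry gQ).
Qed.

Lemma coord_form_diagonal q : chart_dom c q -> omega (diagonal_field q) = 3.
Proof.
move=> cq; rewrite coord_form.unlock /diagonal_field components_frameK// /coord_sum sum3 !mxE.
by ring.
Qed.

Lemma coord_form_linear q (a : R) (x y : tangent q) : chart_dom c q ->
  omega (a *: x + y) = a * omega x + omega y.
Proof.
move=> cq; rewrite coord_form.unlock /coord_sum components_linear// mulr_sumr -big_split.
by apply: eq_bigr => i _; rewrite !mxE.
Qed.

(** Since [Q] is an isometry of order 3, [g (Q x) y = g x (Q^2 y)], and [Q y + Q^2 y] is
    the orbit sum of [y] minus [y]. With [metric_diagonal] this reads
    [g~ + g = psi omega (x) omega], where [psi] is [diagonal_eigenvalue]: the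
    associated metric differs from a rank one tensor by the parallel tensor [- g]. *)
Lemma associated_metricE q (x y : tangent q) : chart_dom c q ->
  associated_metric g Q x y = g x (diagonal_field q) * omega y - g x y.
Proof.
move=> cq; rewrite /associated_metric.
have gDr (z u v : tangent q) : g z (u + v) = g z u + g z v.
  exact: (bilinDr (metric_linear gM (p:=q)) (Defs.metric_sym gM (p:=q))).
have gZr a (z u : tangent q) : g z (a *: u) = a * g z u.
  exact: (bilinZr (metric_linear gM (p:=q)) (Defs.metric_sym gM (p:=q))).
have -> : g (Q x) y = g x (Q (Q y)).
  by rewrite -(circulant_isometry gQ x (Q (Q y))) (circulant_cube gQ).
apply/eqP; rewrite eq_sym subr_eq; apply/eqP.
by rewrite mulrC -gZr -circulant_orbit_sum// !gDr; ring.
Qed.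

Lemma associated_frame q (v w : 'rV[R]_3) : chart_dom c q ->
  associated_metric g Q (frame c v q) (frame c w q) =
  (coord_sum v * coord_sum w - coord_dot v w) * entryA q +
  (coord_sum v * coord_sum w + coord_dot v w) * entryB q.
Proof.
move=> cq; rewrite associated_metricE// metric_diagonal// metric_frame// coord_form.unlock.
by rewrite (components_frameK v ac cq) (components_frameK w ac cq) /diagonal_eigenvalue; ring.
Qed.

Lemma differentiable_metric q i j : chart_dom c q ->
  differentiable_at (fun r => g (coord_vec c r i) (coord_vec c r j)) q.
Proof.
move=> cq; apply: (differentiable_change_chart (d := c)) => //.
- exact: chart_at_atlas.
- exact: mem_chart_at.
- by apply: (metric_smooth gM ac i j 0%N); exists q.
Qed.

Lemma differentiable_diagonal_entry q : chart_dom c q -> differentiable_at entryA q.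
Proof. by move=> cq; rewrite diagonal_entry.unlock; exact: differentiable_metric. Qed.

Lemma differentiable_offdiagonal_entry q : chart_dom c q -> differentiable_at entryB q.
Proof. by move=> cq; rewrite offdiagonal_entry.unlock; exact: differentiable_metric. Qed.

Lemma dfun_metric_frame q (v w : 'rV[R]_3) (x : tangent q) : chart_dom c q ->
  dfun (fun r => g (frame c v r) (frame c w r)) x =
  coord_dot v w * dfun entryA x + (coord_sum v * coord_sum w - coord_dot v w) * dfun entryB x.
Proof.
move=> cq; have dA := differentiable_diagonal_entry cq.
have dB := differentiable_offdiagonal_entry cq; rewrite -dfun_comb//.
by apply: eq_dfun; apply: filterS (near_chart_dom cq) => r cr; exact: metric_frame.
Qed.

Lemma dfun_associated_frame q (v w : 'rV[R]_3) (x : tangent q) : chart_dom c q ->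
  dfun (fun r => associated_metric g Q (frame c v r) (frame c w r)) x =
  (coord_sum v * coord_sum w - coord_dot v w) * dfun entryA x +
  (coord_sum v * coord_sum w + coord_dot v w) * dfun entryB x.
Proof.
move=> cq; have dA := differentiable_diagonal_entry cq.
have dB := differentiable_offdiagonal_entry cq; rewrite -dfun_comb//.
by apply: eq_dfun; apply: filterS (near_chart_dom cq) => r cr; exact: associated_frame.
Qed.

(** Fields with constant components have zero Lie bracket. The torsion condition is
    tested on the coordinate functions, whose differentials separate vectors. *)
Lemma connection_frame_comm (nabla : forall p : M, tangent p -> vfield M -> tangent p) :
  levi_civita g nabla -> forall q (v w : 'rV[R]_3), chart_dom c q ->
  nabla q (frame c v q) (frame c w) = nabla q (frame c w q) (frame c v).
Proof.
move=> LC q v w cq; apply/eqP; rewrite -subr_eq0; apply/eqP.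
set d : tangent q := _ - _.
have d0 : components c d = 0.
  apply/rowP => k; rewrite [RHS]mxE -dfun_coordinate// /d.
  rewrite (levi_civita_torsion_free LC); last 3 first.
  - exact: vsmooth_frame.
  - exact: vsmooth_frame.
  - exact: smooth_coordinate.
  (* The coordinate functions have constant derivatives along both fields. *)
  have cst0 (u u' : 'rV[R]_3) :
      dfun (fun r => dfun (fun s => chart_map c s 0 k) (frame c u r)) (frame c u' q) = 0.
    rewrite -[RHS](dfun_cst (u 0 k) (frame c u' q)); apply: eq_dfun.
    apply: filterS (near_chart_dom cq) => r cr.
    by rewrite dfun_coordinate// components_frameK.
  apply/eqP; rewrite subr_eq0; apply/eqP.
  exact: (etrans (cst0 w v) (esym (cst0 v w))).
by rewrite (componentsE d cq) d0 big1// => i _; rewrite mxE scale0r.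
Qed.

(** The derivative of [g] along [diagonal_field], on fields with constant components. *)
Definition metric_diff_diagonal q (x y : tangent q) : R :=
  coord_product c x y * dfun entryA (diagonal_field q) +
  (omega x * omega y - coord_product c x y)
    * dfun entryB (diagonal_field q).

(** The Koszul formula for three commuting fields, the third one being the diagonal
    field: metric compatibility is added for two of the cyclic arrangements and
    subtracted for the third. *)
Lemma koszul_diagonal (nabla : forall p : M, tangent p -> vfield M -> tangent p) :
  levi_civita g nabla -> forall q (v w : 'rV[R]_3), chart_dom c q ->
  2 * g (nabla q (frame c v q) (frame c w)) (diagonal_field q) =
  coord_sum w * eigenvalue_diff g c (frame c v q)
    + coord_sum v * eigenvalue_diff g c (frame c w q)
    - metric_diff_diagonal (frame c v q) (frame c w q).
Proof.
move=> LC q v w cq.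
pose s : 'rV[R]_3 := const_mx 1.
pose G (a b d : 'rV[R]_3) : R := g (nabla q (frame c a q) (frame c b)) (frame c d q).
pose dA (a : 'rV[R]_3) : R := dfun entryA (frame c a q).
pose dB (a : 'rV[R]_3) : R := dfun entryB (frame c a q).
have Gs a b d : G a b d = G b a d.
  exact: (congr1 (fun x => g x (frame c d q)) (connection_frame_comm LC a b cq)).
have Gm a b d : G a b d + G a d b =
    coord_dot b d * dA a + (coord_sum b * coord_sum d - coord_dot b d) * dB a.
  have H := levi_civita_metric LC (frame c a q) (vsmooth_frame b ac cq) (vsmooth_frame d ac cq).
  have := etrans (esym H) (dfun_metric_frame b d (frame c a q) cq).
  by move=> <-; congr (_ + _); exact: Defs.metric_sym.
have ds (u : 'rV[R]_3) : coord_dot u s = coord_sum u.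
  by rewrite /coord_dot /coord_sum; apply: eq_bigr => i _; rewrite mxE mulr1.
have ss : coord_sum s = 3 by rewrite /coord_sum sum3 !mxE; ring.
rewrite /metric_diff_diagonal coord_product.unlock coord_form.unlock.
rewrite (components_frameK v ac cq) (components_frameK w ac cq) eigenvalue_diff.unlock.
change (2 * G v w s = coord_sum w * (dA v + 2 * dB v) + coord_sum v * (dA w + 2 * dB w)
  - (coord_dot v w * dA s + (coord_sum v * coord_sum w - coord_dot v w) * dB s)).
(* Once G, dA and dB are abstract, the identity is linear in them. *)
move: (Gm v w s) (Gm w v s) (Gm s v w) (Gs s v w) (Gs s w v) (Gs w v s).
clearbody G dA dB; rewrite !ds ss => m1 m2 m3 e1 e2 e3.
by lra.
Qed.

(** As [g] is parallel, only [psi omega (x) omega] contributes to [F]. Its covariant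
    derivative involves the connection through [psi * omega (nabla_x Y)] alone, which
    is [g (nabla_x Y)] applied to the diagonal field, known from [koszul_diagonal]. *)
Lemma covariant_derivative_frame (nabla : forall p : M, tangent p -> vfield M -> tangent p)
    (F : tensor03 M) :
  levi_civita g nabla -> covariant_derivative nabla (associated_metric g Q) F ->
  forall q (x y z : tangent q), chart_dom c q ->
  2 * F q x y z =
  omega z * metric_diff_diagonal x y + omega y * metric_diff_diagonal x z
    - omega x * (omega z * eigenvalue_diff g c y + omega y * eigenvalue_diff g c z).
Proof.
move=> LC FP q x y z cq.
(* Extend the three vectors to fields with constant components. *)
rewrite -(frame_componentsK x ac cq) -(frame_componentsK y ac cq) -(frame_componentsK z ac cq).
move: (components c x) (components c y) (components c z) => u v w {x y z}.
have FE := FP q (frame c u q) _ _ (vsmooth_frame v ac cq) (vsmooth_frame w ac cq).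
have h1 := dfun_associated_frame v w (frame c u q) cq.
have h2 := associated_metricE (nabla q (frame c u q) (frame c v)) (frame c w q) cq.
have h3 := associated_metricE (nabla q (frame c u q) (frame c w)) (frame c v q) cq.
have mc := levi_civita_metric LC (frame c u q) (vsmooth_frame v ac cq) (vsmooth_frame w ac cq).
have md := dfun_metric_frame v w (frame c u q) cq.
have k1 := koszul_diagonal LC u v cq.
have k2 := koszul_diagonal LC u w cq.
have tE : eigenvalue_diff g c (frame c u q) =
    dfun entryA (frame c u q) + 2 * dfun entryB (frame c u q).
  by rewrite eigenvalue_diff.unlock.
rewrite tE in k1; rewrite tE in k2.
have assocC : forall a b : tangent q, associated_metric g Q a b = associated_metric g Q b a.
  by move=> a b; rewrite /associated_metric addrC; congr (_ + _); exact: Defs.metric_sym.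
have fv (a : 'rV[R]_3) : omega (frame c a q) = coord_sum a.
  by rewrite coord_form.unlock components_frameK.
rewrite (fv w) in h2; rewrite (fv v) in h3; rewrite (fv u) (fv v) (fv w).
(* n1 and n2 are the values of g at the covariant derivatives and the diagonal field. *)
have algebra (f su sv sw d da db g1 g2 n1 n2 tv tw d1 d2 : R) :
    f = (sv * sw - d) * da + (sv * sw + d) * db - (n1 * sw - g1) - (n2 * sv - g2) ->
    d * da + (sv * sw - d) * db = g1 + g2 ->
    2 * n1 = sv * (da + 2 * db) + su * tv - d1 ->
    2 * n2 = sw * (da + 2 * db) + su * tw - d2 ->
    2 * f = sw * d1 + sv * d2 - su * (sw * tv + sv * tw).
  move=> -> gE n1E n2E.
  transitivity (2 * ((sv * sw - d) * da + (sv * sw + d) * db)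
    - sw * (2 * n1) - sv * (2 * n2) + 2 * (g1 + g2)); first by ring.
  by rewrite n1E n2E -gE; ring.
apply: algebra _ k1 k2; last first.
- exact: (etrans (esym md) (etrans mc (congr1 (+%R _) (Defs.metric_sym gM _ _)))).
- exact: (etrans FE (congr2 (fun a b => a - b) (congr2 (fun a b => a - b) h1 h2)
    (etrans (assocC _ _) h3))).
Qed.

End CirculantManifold.

(** * The Lee forms *)

Section LeeForms.
Context (R : realType) (M : manifold R) (g : tensor02 M) (Q : tensor11 M).
Context (gQ : circulant_structure g Q).
Context (c : chart R M) (ac : atlas c) (cQ : circulant_chart g Q c).
Context (nabla : forall p : M, tangent p -> vfield M -> tangent p) (F : tensor03 M).
Context (LC : levi_civita g nabla).
Context (FP : covariant_derivative nabla (associated_metric g Q) F).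
Context (p : M) (cp : chart_dom c p).

Let gM : riemannian_metric g := circulant_metric gQ.
Local Notation A := (diagonal_entry g c p).
Local Notation B := (offdiagonal_entry g c p).
Local Notation D := (diagonal_field c p).
Local Notation psi := (diagonal_eigenvalue g c p).
Local Notation omega := (coord_form c (q:=p)).

(** The explicit value of the starred Lee form. The coefficient of [omega] is the
    number [kappa] in the decomposition [D g = tau g + kappa omega (x) omega] of the
    derivative of [g] along the diagonal field, which exists because circulant
    symmetric matrices form a two-dimensional space. *)
Definition lee_star (x : tangent p) : R :=
  3 / (2 * psi) *
  ((A * dfun (offdiagonal_entry g c) D - B * dfun (diagonal_entry g c) D) / (A - B)
     * coord_form c x - eigenvalue_diff g c x).

Lemma eigenvalue_diff_linear (a : R) (x y : tangent p) :
  eigenvalue_diff g c (a *: x + y) = a * eigenvalue_diff g c x + eigenvalue_diff g c y.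
Proof.
rewrite eigenvalue_diff.unlock (dfun_linear a x y (differentiable_diagonal_entry gQ ac cp)).
rewrite (dfun_linear a x y (differentiable_offdiagonal_entry gQ ac cp)).
by rewrite mulrDr [a * (_ + _)]mulrDr [a * (2 * _)]mulrCA addrACA.
Qed.

Lemma lee_star_linear (a : R) (x y : tangent p) :
  lee_star (a *: x + y) = a * lee_star x + lee_star y.
Proof. by rewrite /lee_star (coord_form_linear ac a x y cp) eigenvalue_diff_linear; ring. Qed.

Lemma lee_star_diagonal :
  lee_star D =
  - (3 / 2) * ((dfun (diagonal_entry g c) D - dfun (offdiagonal_entry g c) D) / (A - B)).
Proof.
have /andP[B0 AB] := entry_bounds cQ cp.
have psi0 : A + 2 * B != 0 by apply: lt0r_neq0; lra.
have AB0 : A - B != 0 by apply: lt0r_neq0; lra.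
rewrite /lee_star (coord_form_diagonal ac cp) eigenvalue_diff.unlock /diagonal_eigenvalue.
move: (dfun (diagonal_entry g c) D) (dfun (offdiagonal_entry g c) D) => a b.
by field; rewrite psi0 AB0.
Qed.

(** Substitute [D g = tau g + kappa omega (x) omega] in [covariant_derivative_frame];
    [tau] is recovered from [lee_star_diagonal], as [lee_star D = - 3/2 tau]. *)
Lemma covariant_derivative_lee (x y z : tangent p) :
  F x y z =
  1 / 3 * (psi * coord_form c x * (coord_form c y * lee_star z + coord_form c z * lee_star y)
    - lee_star D * (coord_form c z * g x y + coord_form c y * g x z)).
Proof.
have /andP[B0 AB] := entry_bounds cQ cp.
have psi0 : A + 2 * B != 0 by apply: lt0r_neq0; lra.
have AB0 : A - B != 0 by apply: lt0r_neq0; lra.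
have two0 : (2 : R) != 0 by lra.
apply: (mulfI two0); rewrite (covariant_derivative_frame gQ ac cQ LC FP x y z cp).
rewrite (metric_components gQ ac cQ x y cp) (metric_components gQ ac cQ x z cp).
rewrite lee_star_diagonal /lee_star /metric_diff_diagonal /diagonal_eigenvalue.
move: (eigenvalue_diff g c y) (eigenvalue_diff g c z).
move: (dfun (diagonal_entry g c) D) (dfun (offdiagonal_entry g c) D).
move: (coord_form c x) (coord_form c y) (coord_form c z) => wx wy wz a b ty tz.
move: (coord_product c x y) (coord_product c x z) => dxy dxz.
by field; rewrite psi0 AB0.
Qed.

(** Eliminate [psi omega (x) omega] in favour of [g~ + g]. The linear form [lee] is
    [- lee_star \o (Q + Q^2)], by [circulant_orbit_sum]. *)
Lemma covariant_derivative_decomposition (x y z : tangent p) :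
  let lee w := lee_star w - coord_form c w * lee_star D in
  F x y z =
  1 / 3 * (g x y * lee z + g x z * lee y + associated_metric g Q x y * lee_star z
           + associated_metric g Q x z * lee_star y).
Proof.
rewrite /= covariant_derivative_lee !(associated_metricE gQ ac cQ _ _ cp).
by rewrite (metric_diagonal gQ ac cQ x cp); ring.
Qed.

Context (e : 3.-tuple (tangent p)) (e_basis : basis_of fullv e).

Local Notation tr := (metric_contraction (g (p:=p)) e).
Let tr_left := metric_contraction_left (metric_linear gM (p:=p)) (Defs.metric_sym gM (p:=p))
  (metric_pos gM (p:=p)) e_basis.

Lemma trace_components (L : tangent p -> tangent p) :
  (forall a x y, L (a *: x + y) = a *: L x + L y) ->
  tr (fun x y => g x (L y)) = \sum_k components c (L (coord_vec c p k)) 0 k.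
Proof.
move=> lL.
apply: (metric_contraction_trace (metric_linear gM (p:=p)) (Defs.metric_sym gM (p:=p))
  (metric_pos gM (p:=p)) e_basis (u := fun k x => components c x 0 k)) => //.
- by move=> k a x y; rewrite components_linear// !mxE.
- by move=> x; exact: componentsE.
Qed.

Lemma components_coord_vec k : components c (coord_vec c p k) = delta_mx 0 k.
Proof. by have := components_frameK (delta_mx 0 k) ac cp; rewrite frame.unlock. Qed.

Lemma trace_metric : tr (g (p:=p)) = 3.
Proof.
rewrite (trace_components (L := id))// (eq_bigr (fun=> 1)) => [|k _].
  by rewrite sumr_const card_ord.
by rewrite components_coord_vec mxE !eqxx.
Qed.

(** [Q] permutes the coordinate frame without fixed points. *)
Lemma trace_circulant : tr (fun x y => g x (Q y)) = 0.
Proof.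
have [Q0 Q1 Q2 _] := cQ cp.
rewrite (trace_components (L := Q (p:=p))); last first.
  exact: (tensor11_linear (circulant_tensor gQ) (p:=p)).
have offdiag (x : tangent p) k l : x = coord_vec c p k -> l != k -> components c x 0 l = 0.
  by move=> -> lk; rewrite components_coord_vec mxE (negPf lk) andbF.
have d0 := offdiag _ _ 0 Q0 isT; have d1 := offdiag _ _ 1 Q1 isT.
have d2 := offdiag _ _ 2 Q2 isT; rewrite sum3.
by apply: etrans (congr2 +%R (congr2 +%R d0 d1) d2) _; rewrite !addr0.
Qed.

(** Each term of [F x (Q y) z] is a multiple of [g x (Q y)], whose contraction is the
    trace of [Q], or a product of [g x w] with a linear form of [y], contracted by
    evaluating that form at [w]. *)
Lemma lee_form_starE (z : tangent p) : lee_form_star g Q F e z = lee_star z.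
Proof.
transitivity (tr (fun x y => F x (Q y) z)); first by [].
pose mu1 (y : tangent p) := - (lee_star D / 3) * coord_form c y.
pose mu2 (y : tangent p) := (coord_form c y * lee_star z + coord_form c z * lee_star (Q y)) / 3.
rewrite (@eq_metric_contraction _ _ _ _ _ _ (fun x y =>
  - (lee_star D * coord_form c z / 3) * g x (Q y) +
  (1 * (g x z * mu1 y) + g x D * mu2 y))); last first.
  move=> x y; rewrite covariant_derivative_lee (coord_form_circulant gQ ac cQ y cp).
  by rewrite (metric_diagonal gQ ac cQ x cp) /mu1 /mu2; field.
rewrite !metric_contraction_comb trace_circulant !tr_left /mu1 /mu2.
- by rewrite (circulant_diagonal gQ ac cQ cp) (coord_form_diagonal ac cp); field.
- move=> a x y; rewrite (tensor11_linear (circulant_tensor gQ)).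
  by rewrite lee_star_linear (coord_form_linear ac a x y cp); ring.
- by move=> a x y; rewrite (coord_form_linear ac a x y cp); ring.
Qed.

(** As for [lee_form_starE], with the trace of the identity instead of that of [Q]. *)
Lemma lee_formE (z : tangent p) :
  lee_form g F e z = lee_star z - coord_form c z * lee_star D.
Proof.
transitivity (tr (fun x y => F x y z)); first by [].
pose mu1 (y : tangent p) := - (lee_star D / 3) * coord_form c y.
pose mu2 (y : tangent p) := (coord_form c y * lee_star z + coord_form c z * lee_star y) / 3.
rewrite (@eq_metric_contraction _ _ _ _ _ _ (fun x y =>
  - (lee_star D * coord_form c z / 3) * g x y +
  (1 * (g x z * mu1 y) + g x D * mu2 y))); last first.
  move=> x y; rewrite covariant_derivative_lee.
  by rewrite (metric_diagonal gQ ac cQ x cp) /mu1 /mu2; field.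
rewrite !metric_contraction_comb trace_metric !tr_left /mu1 /mu2.
- by rewrite (coord_form_diagonal ac cp); field.
- by move=> a x y; rewrite lee_star_linear (coord_form_linear ac a x y cp); ring.
- by move=> a x y; rewrite (coord_form_linear ac a x y cp); ring.
Qed.

End LeeForms.

(** * Conformal change of the metric *)

Section Conformal.
Context (R : realType) (M : manifold R) (g : tensor02 M) (Q : tensor11 M) (alpha : M -> R).
Context (gQ : circulant_structure g Q).
Context (alpha_smooth : smooth_on [set: M] alpha) (alpha_gt0 : forall p : M, 0 < alpha p).

Local Notation gbar := (conformal_metric alpha g).

Lemma conformal_riemannian : riemannian_metric gbar.
Proof.
have [lin sym pos sm] := circulant_metric gQ; split.
- by move=> p a x x' y; rewrite /conformal_metric lin; ring.
- by move=> p x y; rewrite /conformal_metric sym.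
- by move=> p x x0; rewrite mulr_gt0// pos.
- move=> c ac i j; apply: smooth_realM; [exact: chart_img_open| |exact: sm].
  by have := alpha_smooth ac; rewrite setIT.
Qed.

Lemma conformal_circulant_chart (c : chart R M) :
  circulant_chart g Q c -> circulant_chart gbar Q c.
Proof.
move=> cQ p cp; have [Q0 Q1 Q2 /andP[B0 AB]] := cQ p cp; split=> //.
rewrite /conformal_metric; apply/andP; split; first exact: (mulr_gt0 (alpha_gt0 p) B0).
by rewrite (ltr_pM2l (alpha_gt0 p)) AB.
Qed.

Lemma conformal_circulant : circulant_structure gbar Q.
Proof.
split.
- exact: conformal_riemannian.
- exact: circulant_tensor gQ.
- exact: circulant_cube gQ.
- exact: circulant_neq_id gQ.
- by move=> p x y; rewrite /conformal_metric (circulant_isometry gQ).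
- move=> p; have [c [ac cp cQ]] := circulant_charts gQ p; exists c; split=> //.
  exact: conformal_circulant_chart.
Qed.

Lemma differentiable_conformal_factor p : differentiable_at alpha p.
Proof.
apply: (alpha_smooth (chart_at_atlas p) 0%N).
by exists p => //; split=> //; exact: mem_chart_at.
Qed.

Context (c : chart R M) (ac : atlas c) (cQ : circulant_chart g Q c).
Context (p : M) (cp : chart_dom c p).

Lemma conformal_diagonal_entry :
  diagonal_entry gbar c = fun q => alpha q * diagonal_entry g c q.
Proof. by rewrite diagonal_entry.unlock. Qed.

Lemma conformal_offdiagonal_entry :
  offdiagonal_entry gbar c = fun q => alpha q * offdiagonal_entry g c q.
Proof. by rewrite offdiagonal_entry.unlock. Qed.

Lemma dfun_conformal_diagonal_entry (x : tangent p) :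
  dfun (diagonal_entry gbar c) x =
  alpha p * dfun (diagonal_entry g c) x + diagonal_entry g c p * dfun alpha x.
Proof.
rewrite conformal_diagonal_entry.
exact: (dfunM x (differentiable_conformal_factor p)
  (differentiable_diagonal_entry gQ ac cp)).
Qed.

Lemma dfun_conformal_offdiagonal_entry (x : tangent p) :
  dfun (offdiagonal_entry gbar c) x =
  alpha p * dfun (offdiagonal_entry g c) x + offdiagonal_entry g c p * dfun alpha x.
Proof.
rewrite conformal_offdiagonal_entry.
exact: (dfunM x (differentiable_conformal_factor p)
  (differentiable_offdiagonal_entry gQ ac cp)).
Qed.

(** Under the scaling the coefficient [kappa] of [lee_star] is multiplied by [alpha],
    because the derivatives of [alpha] cancel in [A dB - B dA]; so is [psi]. Only the
    differential of [alpha] in the differential of [alpha * psi] survives. *)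
Lemma lee_star_conformal (x : tangent p) :
  lee_star gbar c x = lee_star g c x - 3 / (2 * alpha p) * dfun alpha x.
Proof.
have /andP[B0 AB] := entry_bounds cQ cp.
have psi0 : diagonal_entry g c p + 2 * offdiagonal_entry g c p != 0 by apply: lt0r_neq0; lra.
have AB0 : diagonal_entry g c p - offdiagonal_entry g c p != 0 by apply: lt0r_neq0; lra.
have alpha0 : alpha p != 0 by exact: lt0r_neq0.
rewrite /lee_star /diagonal_eigenvalue eigenvalue_diff.unlock.
rewrite (dfun_conformal_diagonal_entry x) (dfun_conformal_diagonal_entry (diagonal_field c p)).
rewrite (dfun_conformal_offdiagonal_entry x).
rewrite (dfun_conformal_offdiagonal_entry (diagonal_field c p)).
rewrite conformal_diagonal_entry conformal_offdiagonal_entry.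
move: (dfun (diagonal_entry g c) x) (dfun (offdiagonal_entry g c) x) (dfun alpha x).
move: (dfun (diagonal_entry g c) _) (dfun (offdiagonal_entry g c) _) (dfun alpha _).
move: psi0 AB0 alpha0; move: (diagonal_entry g c p) (offdiagonal_entry g c p) (alpha p).
move: (coord_form c x) => w A B f psi0 AB0 f0 a b d ax bx dx.
by field; rewrite psi0 AB0 f0 -mulrBr [2 * (f * B)]mulrCA -mulrDr !mulf_neq0.
Qed.

Lemma dfun_conformal_factor_circulant (x : tangent p) :
  dfun alpha (Q x + Q (Q x)) =
  coord_form c x * dfun alpha (diagonal_field c p) - dfun alpha x.
Proof.
have lin a (u v : tangent p) := dfun_linear a u v (differentiable_conformal_factor p).
have d0 : dfun alpha (0 : tangent p) = 0 by exact: derive0.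
have h1 := lin 1 x (Q x + Q (Q x)); have h2 := lin (coord_form c x) (diagonal_field c p) 0.
rewrite addr0 -(circulant_orbit_sum gQ ac cQ x cp) d0 addr0 in h2.
rewrite -h2; rewrite scale1r mul1r addrA in h1; rewrite h1.
by rewrite addrAC subrr add0r.
Qed.

End Conformal.

Theorem theorem3p2 (R : realType) (M : manifold R)
    (g : tensor02 M) (Q : tensor11 M)
    (nabla : forall p : M, tangent p -> vfield M -> tangent p)
    (F : tensor03 M)
    (alpha : M -> R)
    (nablabar : forall p : M, tangent p -> vfield M -> tangent p)
    (Fbar : tensor03 M)
    (gQ : circulant_structure g Q)
    (nablaP : levi_civita g nabla)
    (FP : covariant_derivative nabla (associated_metric g Q) F)
    (alpha_smooth : smooth_on [set: M]%classic alpha)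
    (alpha_gt0 : forall p : M, 0 < alpha p)
    (nablabarP : levi_civita (conformal_metric alpha g) nablabar)
    (FbarP : covariant_derivative nablabar
               (associated_metric (conformal_metric alpha g) Q) Fbar)
    (p : M) (e : 3.-tuple (tangent p)) (e_basis : basis_of fullv e) :
  let gbar := conformal_metric alpha g in
  let gtbar := associated_metric gbar Q in
  let theta := lee_form g F e in
  let thetastar := lee_form_star g Q F e in
  let thetabar := lee_form gbar Fbar e in
  let thetastarbar := lee_form_star gbar Q Fbar e in
  [/\ forall x y z : tangent p,
        Fbar p x y z =
        1 / 3 * (gbar p x y * thetabar z + gbar p x z * thetabar y
                 + gtbar p x y * thetastarbar z
                 + gtbar p x z * thetastarbar y),
      forall x : tangent p,
        thetabar x =
        theta x + 3 / (2 * alpha p)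
                  * dfun alpha (Q p x + Q p (Q p x)) &
      forall x : tangent p,
        thetastarbar x = thetastar x - 3 / (2 * alpha p) * dfun alpha x].
Proof.
move=> gbar gtbar theta thetastar thetabar thetastarbar.
have [c [ac cp cQ]] := circulant_charts gQ p.
have gbarQ : circulant_structure gbar Q := conformal_circulant gQ alpha_smooth alpha_gt0.
have cQbar : circulant_chart gbar Q c := conformal_circulant_chart alpha_gt0 cQ.
have thetaE x : theta x = _ := lee_formE gQ ac cQ nablaP FP cp e_basis x.
have thetastarE x : thetastar x = _ := lee_form_starE gQ ac cQ nablaP FP cp e_basis x.
have thetabarE x : thetabar x = _ := lee_formE gbarQ ac cQbar nablabarP FbarP cp e_basis x.
have thetastarbarE x : thetastarbar x = _ :=
  lee_form_starE gbarQ ac cQbar nablabarP FbarP cp e_basis x.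
have starE x := lee_star_conformal gQ alpha_smooth alpha_gt0 ac cQ cp x.
split=> [x y z|x|x].
- rewrite (thetabarE y) (thetabarE z) (thetastarbarE y) (thetastarbarE z).
  exact: (covariant_derivative_decomposition gbarQ ac cQbar nablabarP FbarP cp x y z).
- rewrite thetabarE thetaE (starE x) (starE (diagonal_field c p)).
  rewrite (dfun_conformal_factor_circulant gQ alpha_smooth ac cQ cp x).
  by ring.
- by rewrite thetastarbarE thetastarE starE.
Qed.
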